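(* Let $\mathbf{e}_k=\mathbf{Y}_k\mathbf{e}_{k-1}$, where each $\mathbf{Y}_k$ is independently sampled from a family of $n\times n$ matrices such that $\sup_k\left\|\mathbb{E}[\mathbf{Y}_k^\top\mathbf{Y}_k]\right\|\le\rho$. Then the following hold. (a) For any $\epsilon\in(0,1]$, $$\mathbb{P}\left(\forall k\ge 0:\ \|\mathbf{e}_k\|^2\le\epsilon^{-1}\rho^k\|\mathbf{e}_0\|^2\right)\ge 1-\epsilon .$$ (b) If moreover $\sup_k\|\mathbf{Y}_k^\top\mathbf{Y}_k\|\le\alpha$ almost surely for some $\alpha\ge1$ (e.g., if the $\mathbf{Y}_k^\top\mathbf{Y}_k$ are contraction operators, then $\alpha=1$), then, for any $k\ge0$ (and $\epsilon\in(0,1]$ as in (a)), $$\mathbb{P}\left[\sup_{0\le t\le k}\|\mathbf{e}_t\|^2\le\exp\left(-k\cdot(1-\rho)+\alpha\cdot\sqrt{2k\log(\epsilon^{-1})}\right)\|\mathbf{e}_0\|^2\right]\ge1-\epsilon .$$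
   Context: Here $\mathbf{e}_0\in\mathbb{R}^n$ is the initial (error) vector from which the vectors $\mathbf{e}_k$, $k\ge 1$, are generated recursively using the random real matrices $\mathbf{Y}_1,\mathbf{Y}_2,\dots$. For vectors, $\|\cdot\|$ is the Euclidean norm; for matrices, $\|\cdot\|$ is the operator norm. The index $t$ ranges over the integers from $0$ to $k$.
   Formalization: In (b) the exponent's drift −k(1−ρ) is replaced by −t(1−ρ), with the bound holding for all 0≤t≤k simultaneously; as printed (b) fails at t=0 (e.g. Y_k=0, ρ=0, α=1, ε=1/2, k=2). Integrability of the entries of Y_kᵀY_k is made explicit. *)

(* Defs.v *)
From HB Require Import structures.
From mathcomp Require Export all_boot all_order all_algebra.
From mathcomp Require Export all_classical all_reals all_analysis.

Set Implicit Arguments.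
Unset Strict Implicit.
Unset Printing Implicit Defensive.

Import Order.TTheory GRing.Theory Num.Theory.
Import numFieldNormedType.Exports.

Local Open Scope classical_set_scope.
Local Open Scope ring_scope.

(* The norm that MathComp-Analysis puts on matrices is the max norm, so the
   Euclidean norm and the operator norm it induces are defined here. *)
Definition enorm (R : realType) (n : nat) (x : 'cV[R]_n) : R :=
  Num.sqrt (\sum_(i < n) x i 0 ^+ 2).

Definition opnorm (R : realType) (n : nat) (A : 'M[R]_n) : R :=
  sup [set enorm (A *m x) | x in [set x : 'cV[R]_n | enorm x <= 1]].

Definition random_mx d (T : measurableType d) (R : realType) (n : nat)
    (X : T -> 'M[R]_n) : Prop :=
  forall i j, measurable_fun [set: T] (fun w => X w i j).

Definition integrable_mx d (T : measurableType d) (R : realType)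
    (P : probability T R) (n : nat) (X : T -> 'M[R]_n) : Prop :=
  forall i j, P.-integrable [set: T] (EFin \o (fun w => X w i j)).

(* Only meaningful under [integrable_mx P X]: [fine] sends an infinite
   expectation to 0. *)
Definition expectation_mx d (T : measurableType d) (R : realType)
    (P : probability T R) (n : nat) (X : T -> 'M[R]_n) : 'M[R]_n :=
  \matrix_(i, j) fine ('E_P[fun w => X w i j])%E.

(* The Borel sigma-algebra of 'M[R]_n, generated by the entry functions. *)
Definition measurable_mx (R : realType) (n : nat) : set (set 'M[R]_n) :=
  <<s [set A | exists i j (B : set R),
        measurable B /\ A = [set M : 'M[R]_n | B (M i j)]] >>.

(* Mutual independence of the random matrices X k, k ranging over I. *)
Definition independent_mx d (T : measurableType d) (R : realType)
    (P : probability T R) (n : nat) (I : set nat)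
    (X : nat -> T -> 'M[R]_n) : Prop :=
  forall (s : seq nat) (B : nat -> set 'M[R]_n),
    uniq s -> (forall k, k \in s -> I k) ->
    (forall k, k \in s -> measurable_mx (B k)) ->
    P (\bigcap_(k in [set` s]) (X k @^-1` B k)) =
      (\prod_(k <- s) P (X k @^-1` B k))%E.

(* Y 0 is never used. *)
Fixpoint error_vec (T : Type) (R : realType) (n : nat)
    (Y : nat -> T -> 'M[R]_n) (e0 : 'cV[R]_n) (k : nat) (w : T) : 'cV[R]_n :=
  if k is k'.+1 then Y k w *m error_vec Y e0 k' w else e0.

(* Main.v *)
Require Import Defs.
From mathcomp Require Import ring lra measurable_realfun.

(** Write [gain M v] for |M v|^2 / |v|^2, so that |e_k|^2 is |e_0|^2 times the
    product of the gains of Y_1, ..., Y_k, the i-th taken at e_(i-1).  For a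
    fixed vector v the mean of |Y_k v|^2 is the quadratic form of E[Y_k^T Y_k]
    at v, hence the mean gain is at most rho ([integral_gain_le]), whatever v.

    Both bounds come from one maximal inequality.  Let phi be nonnegative with
    E[phi (gain (Y_k, v))] <= 1 for every k and every fixed v.  Because Y_(k+1)
    is independent of the past, the random vector e_k may be treated as fixed
    when integrating over Y_(k+1), so the products of the values phi (gain)
    form a nonnegative supermartingale started at 1, and with probability at
    least 1 - 1/c it never exceeds c ([gain_product_bound]).  No conditional
    expectation is formed: the law of the pair (past, Y_(k+1)) is a product
    measure and the freezing of e_k is Tonelli's theorem
    ([integral_independent_le], [history_independent]); the maximal inequality
    is Ville's ([maximal_inequality]).

    For (a) take phi x = x / rho and c = 1/eps: the supermartingale is
    |e_k|^2 / (rho^k |e_0|^2) when e_0 is nonzero.  If rho = 0 then e_1 = 0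
    almost surely ([error_bound_mean0]).

    For (b), x <= exp (x - 1) turns the product of the gains into the
    exponential of a sum: |e_t|^2 <= exp (- t (1 - rho) + Z_t) |e_0|^2, where
    Z_t is the sum over i <= t of the i-th gain minus rho.  Hoeffding's lemma
    ([exp_moment_le]) lets phi x = exp (s (x - rho) - (s alpha)^2 / 2) into the
    maximal inequality, which gives s Z_t <= ln (1/eps) + t (s alpha)^2 / 2 for
    all t at once; the value of s minimizing the resulting bound at t = k turns
    it into Z_t <= alpha sqrt (2 k ln (1/eps)) for all t <= k. *)

Set Implicit Arguments.
Unset Strict Implicit.
Unset Printing Implicit Defensive.

Import Order.TTheory GRing.Theory Num.Theory.
Import numFieldNormedType.Exports.
Local Open Scope classical_set_scope.
Local Open Scope ring_scope.

(** * Euclidean norm, operator norm and gain *)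

(** Expanding the sum of the squares of [B u_i - C v_i] gives [B (A B - C^2)]. *)
Lemma cauchy_schwarz (R : realFieldType) (I : finType) (u v : I -> R) :
  (\sum_i u i * v i) ^+ 2 <= (\sum_i u i ^+ 2) * (\sum_i v i ^+ 2).
Proof.
set C := \sum_i u i * v i; set A := \sum_i u i ^+ 2; set B := \sum_i v i ^+ 2.
have B0 : 0 <= B by apply: sumr_ge0 => i _; exact: sqr_ge0.
have key : 0 <= B * (A * B - C ^+ 2).
  have -> : B * (A * B - C ^+ 2) = \sum_i (B * u i - C * v i) ^+ 2.
    under eq_bigr => i _.
      have -> : (B * u i - C * v i) ^+ 2 =
          B ^+ 2 * u i ^+ 2 + (- (2 * B * C) * (u i * v i) + C ^+ 2 * v i ^+ 2).
        by ring.
      over.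
    by rewrite !big_split /= -!mulr_sumr -/A -/B -/C; ring.
  by apply: sumr_ge0 => i _; exact: sqr_ge0.
have [B_eq0|B_neq0] := eqVneq B 0; last first.
  by move: key; rewrite pmulr_rge0 ?subr_ge0 // lt_def B_neq0.
have v0 i : v i = 0.
  apply/eqP; rewrite -sqrf_eq0; apply/eqP.
  by apply: (psumr_eq0P _ B_eq0) => // j _; exact: sqr_ge0.
by rewrite B_eq0 mulr0 /C big1 ?expr0n // => i _; rewrite v0 mulr0.
Qed.

Section euclidean.
Context (R : realType) (n : nat).
Implicit Types (v x : 'cV[R]_n) (A M : 'M[R]_n).

Lemma sqr_enorm v : enorm v ^+ 2 = \sum_i v i 0 ^+ 2.
Proof. by rewrite sqr_sqrtr //; apply: sumr_ge0 => i _; exact: sqr_ge0. Qed.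

Lemma enorm_ge0 v : 0 <= enorm v. Proof. exact: sqrtr_ge0. Qed.

Lemma enorm_eq0 v : enorm v = 0 -> v = 0.
Proof.
move=> v0; apply/matrixP => i j; rewrite !mxE ord1.
have : \sum_i v i 0 ^+ 2 = 0 by rewrite -sqr_enorm v0 expr0n.
move=> sum0; apply/eqP; rewrite -sqrf_eq0; apply/eqP.
by apply: (psumr_eq0P _ sum0) => // k _; exact: sqr_ge0.
Qed.

Lemma enorm0 : enorm (0 : 'cV[R]_n) = 0.
Proof. by rewrite /enorm big1 ?sqrtr0 // => i _; rewrite mxE expr0n. Qed.

Lemma enormZ (a : R) v : 0 <= a -> enorm (a *: v) = a * enorm v.
Proof.
move=> a0; apply/eqP; rewrite -(@eqrXn2 _ 2) ?mulr_ge0 ?enorm_ge0 //.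
rewrite exprMn !sqr_enorm mulr_sumr; apply/eqP; apply: eq_bigr => i _.
by rewrite mxE exprMn.
Qed.

(** The Frobenius norm bounds the set whose supremum is the operator norm. *)
Lemma opnorm_has_sup A :
  has_sup [set enorm (A *m x) | x in [set x : 'cV[R]_n | enorm x <= 1]].
Proof.
split; first by exists (enorm (A *m 0)); exists 0 => //=; rewrite enorm0.
set F := \sum_i \sum_j A i j ^+ 2.
have F0 : 0 <= F.
  by apply: sumr_ge0 => i _; apply: sumr_ge0 => j _; exact: sqr_ge0.
exists (Num.sqrt F) => _ [x /= x1 <-]; rewrite /enorm ler_wsqrtr //.
apply: ler_sum => i _; rewrite mxE.
apply: le_trans (cauchy_schwarz (A i) (x ^~ 0)) _; rewrite -sqr_enorm.
rewrite ler_piMr //; first by apply: sumr_ge0 => j _; exact: sqr_ge0.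
by rewrite expr_le1 ?enorm_ge0.
Qed.

Lemma opnorm_ge0 A : 0 <= opnorm A.
Proof.
apply: le_trans (enorm_ge0 (A *m 0)) _.
apply: (sup_upper_bound (opnorm_has_sup A)).
by exists 0 => //=; rewrite enorm0.
Qed.

Lemma enorm_mulmx_le A x : enorm (A *m x) <= opnorm A * enorm x.
Proof.
have [x0|x0] := eqVneq (enorm x) 0.
  by rewrite (enorm_eq0 x0) mulmx0 !enorm0 mulr0.
have x_gt0 : 0 < enorm x by rewrite lt_def x0 enorm_ge0.
rewrite -ler_pdivrMr // mulrC -enormZ ?invr_ge0 ?enorm_ge0 // scalemxAr.
apply: (sup_upper_bound (opnorm_has_sup A)); exists ((enorm x)^-1 *: x) => //=.
by rewrite enormZ ?invr_ge0 ?enorm_ge0 // mulVf.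
Qed.

(** Cauchy-Schwarz between [v] and [A v]. It is used both for E[Y^T Y], to bound
    the mean gain, and for Y^T Y itself, to bound the gain ([gain_le]). *)
Lemma quadratic_form_le A v :
  \sum_i v i 0 * (A *m v) i 0 <= opnorm A * enorm v ^+ 2.
Proof.
apply: le_trans (ler_norm _) _.
have -> : opnorm A * enorm v ^+ 2 = enorm v * (opnorm A * enorm v) by ring.
apply: le_trans (ler_wpM2l (enorm_ge0 v) (enorm_mulmx_le A v)).
rewrite -(@ler_pXn2r _ 2) ?nnegrE ?normr_ge0 ?mulr_ge0 ?enorm_ge0 //.
rewrite real_normK ?num_real // exprMn !sqr_enorm.
exact: (cauchy_schwarz (v ^~ 0) ((A *m v) ^~ 0)).
Qed.

Lemma sqr_enorm_mulmx M v :
  enorm (M *m v) ^+ 2 = \sum_i v i 0 * (M^T *m M *m v) i 0.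
Proof.
have -> : \sum_i v i 0 * (M^T *m M *m v) i 0 = (v^T *m (M^T *m M *m v)) 0 0.
  by rewrite [RHS]mxE; apply: eq_bigr => i _; rewrite [v^T _ _]mxE.
rewrite -(mulmxA M^T) mulmxA -trmx_mul sqr_enorm [RHS]mxE.
by apply: eq_bigr => i _; rewrite [(M *m v)^T _ _]mxE expr2.
Qed.

(** At [v = 0] the convention [0^-1 = 0] makes [gain M v] equal to [0], so
    [sqr_enorm_gain] holds without exception. *)
Definition gain M v : R := enorm (M *m v) ^+ 2 / enorm v ^+ 2.

Lemma gain_ge0 M v : 0 <= gain M v.
Proof. by rewrite divr_ge0 ?sqr_ge0. Qed.

Lemma sqr_enorm_gain M v : enorm (M *m v) ^+ 2 = gain M v * enorm v ^+ 2.
Proof.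
have [v0|v0] := eqVneq (enorm v) 0.
  by rewrite (enorm_eq0 v0) mulmx0 !enorm0 expr0n mulr0.
by rewrite /gain divfK // sqrf_eq0.
Qed.

Lemma gain_le M v : gain M v <= opnorm (M^T *m M).
Proof.
have [v0|v0] := eqVneq (enorm v) 0.
  by rewrite /gain v0 expr0n invr0 mulr0 opnorm_ge0.
rewrite /gain ler_pdivrMr ?sqr_enorm_mulmx ?quadratic_form_le //.
by rewrite lt_def sqrf_eq0 v0 sqr_ge0.
Qed.

End euclidean.

(** * Hyperbolic functions *)

Section hyperbolic.
Context (R : realType).
Implicit Types h x : R.

Lemma le_of_derive_ge0 (f df : R -> R) x :
  0 <= x -> (forall y : R, is_derive y 1 f (df y)) -> (forall y, 0 <= y -> 0 <= df y) ->
  f 0 <= f x.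
Proof.
move=> x0 fdf df0; rewrite -subr_ge0.
have [|c c0x ->] := @MVT_segment _ f df _ _ x0 (fun y _ => fdf y).
  apply: derivable_within_continuous => y _; exact: ex_derive.
by rewrite subr0 mulr_ge0 // df0 // (itvP c0x).
Qed.

Definition cosh x : R := (expR x + expR (- x)) / 2.
Definition sinh x : R := (expR x - expR (- x)) / 2.

Lemma is_derive_cosh x : is_derive x 1 cosh (sinh x).
Proof.
have h : is_derive x 1 (2^-1 *: (expR + (expR \o -%R))) (sinh x).
  apply: is_derive_eq.
  rewrite /sinh /GRing.scale /=; ring.
have -> : cosh = 2^-1 *: (expR + (expR \o -%R)).
  by apply/funext => y; rewrite /cosh [RHS]/GRing.scale /= mulrC.
exact: h.
Qed.

Lemma is_derive_sinh x : is_derive x 1 sinh (cosh x).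
Proof.
have h : is_derive x 1 (2^-1 *: (expR - (expR \o -%R))) (cosh x).
  apply: is_derive_eq.
  rewrite /cosh /GRing.scale /=; ring.
have -> : sinh = 2^-1 *: (expR - (expR \o -%R)).
  by apply/funext => y; rewrite /sinh [RHS]/GRing.scale /= mulrC.
exact: h.
Qed.

#[local] Existing Instance is_derive_cosh.
#[local] Existing Instance is_derive_sinh.

Lemma sinh_ge0 x : 0 <= x -> 0 <= sinh x.
Proof.
by move=> x0; rewrite divr_ge0 // subr_ge0 ler_expR; lra.
Qed.

Lemma sinh_le_mul_cosh x : 0 <= x -> sinh x <= x * cosh x.
Proof.
move=> x0; rewrite -subr_ge0.
have -> : 0 = 0 * cosh 0 - sinh 0 by rewrite mul0r /sinh oppr0 subrr mul0r subrr.
apply: (@le_of_derive_ge0 (fun y => y * cosh y - sinh y) (fun y => y * sinh y)) => //.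
  move=> y.
  have h : is_derive y 1 (id * cosh - sinh) (y * sinh y).
    apply: is_derive_eq.
    rewrite /GRing.scale /=; ring.
  exact: h.
by move=> y y0; rewrite mulr_ge0 // sinh_ge0.
Qed.

(** The function [exp (- y^2 / 2) * cosh y] equals 1 at 0, and its derivative has
    the sign of [sinh y - y * cosh y]. *)
Lemma cosh_le_expR x : 0 <= x -> cosh x <= expR (x ^+ 2 / 2).
Proof.
move=> x0.
rewrite -[leRHS]mul1r -ler_pdivrMr ?expR_gt0 // -expRN mulrC -lerN2.
have -> : -1 = - (expR (- (0 ^+ 2 / 2)) * cosh 0).
  by rewrite expr0n mul0r oppr0 /cosh oppr0 expR0 /= mul1r divff.
apply: (@le_of_derive_ge0 (fun y => - (expR (- (y ^+ 2 / 2)) * cosh y))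
  (fun y => expR (- (y ^+ 2 / 2)) * (y * cosh y - sinh y))) => //.
  move=> y.
  pose g : R -> R := - 2^-1 *: (id ^+ 2).
  have gE z : g z = - (z ^+ 2 / 2).
    by rewrite /g [LHS]/GRing.scale /= [LHS]/GRing.scale /= mulNr mulrC.
  have dg : is_derive y 1 g (- y).
    by apply: is_derive_eq; rewrite /GRing.scale /= /GRing.exp /=; field.
  have h : is_derive y 1 (- ((expR \o g) * cosh))
      (expR (g y) * (y * cosh y - sinh y)).
    by apply: is_derive_eq; rewrite /GRing.scale /=; ring.
  rewrite -gE (_ : (fun _ => _) = - ((expR \o g) * cosh)) //.
  by apply/funext => z; rewrite -gE.
by move=> y y0; rewrite mulr_ge0 ?expR_ge0 // subr_ge0 sinh_le_mul_cosh.
Qed.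

(** Convexity of the exponential: [h * t] is the average of [h] and [- h] with
    weights (1 + t) / 2 and (1 - t) / 2, and averaging the tangent inequality at
    [h * t] over these two points gives the claim. *)
Lemma expR_le_chord h t : -1 <= t <= 1 -> expR (h * t) <= cosh h + t * sinh h.
Proof.
move=> /andP[t_ge t_le]; set m := h * t.
have tangent a : expR m * (1 + (a - m)) <= expR a.
  have -> : expR a = expR m * expR (a - m) by rewrite -expRD addrC subrK.
  by rewrite ler_wpM2l ?expR_ge0 ?expR_ge1Dx.
have p0 : 0 <= (1 + t) / 2 by lra.
have q0 : 0 <= (1 - t) / 2 by lra.
have := lerD (ler_wpM2l p0 (tangent h)) (ler_wpM2l q0 (tangent (- h))).
by rewrite /cosh /sinh /m; set E := expR (h * t); lra.
Qed.

Lemma sinh_le_cosh x : sinh x <= cosh x.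
Proof. by rewrite ler_pM2r ?invr_gt0 //; have := expR_gt0 (- x); lra. Qed.

Lemma cosh_ge1 x : 1 <= cosh x.
Proof.
by rewrite /cosh; have := expR_ge1Dx x; have := expR_ge1Dx (- x); lra.
Qed.

End hyperbolic.

(** * Freezing an independent variable; Ville's inequality *)

(** Independence says that the law of (Z, Y) is the product of the laws, so
    Tonelli's theorem integrates over [Y] first, with [Z] frozen at [z].  This
    plays the role of bounding E[f (Z, Y) | Z] by g (Z). *)
Lemma integral_independent_le d d1 d2 (T : measurableType d)
    (S : measurableType d1) (U : measurableType d2) (R : realType)
    (P : probability T R) (Z : T -> S) (Y : T -> U) (f : S * U -> \bar R)
    (g : S -> \bar R) :
  measurable_fun [set: T] Z -> measurable_fun [set: T] Y ->
  (forall A B, measurable A -> measurable B ->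
     P (Z @^-1` A `&` Y @^-1` B) = (P (Z @^-1` A) * P (Y @^-1` B))%E) ->
  measurable_fun setT f -> (forall x, 0 <= f x)%E ->
  measurable_fun [set: S] g -> (forall z, \int[P]_w f (z, Y w) <= g z)%E ->
  (\int[P]_w f (Z w, Y w) <= \int[P]_w g (Z w))%E.
Proof.
move=> mZ mY indep mf f0 mg fg.
pose Z' : {mfun T >-> S} := mfun_Sub (mem_set mZ).
pose Y' : {mfun T >-> U} := mfun_Sub (mem_set mY).
have mZY : measurable_fun [set: T] (fun w => (Z w, Y w)).
  exact: measurable_fun_pair.
pose ZY : {mfun T >-> (S * U)%type} := mfun_Sub (mem_set mZY).
have -> : (\int[P]_w f (Z w, Y w) = \int[distribution P ZY]_x f x)%E.
  by rewrite ge0_integral_distribution.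
have -> : (\int[distribution P ZY]_x f x =
    \int[(distribution P Z' \x distribution P Y')%E]_x f x)%E.
  apply: eq_measure_integral => A mA _.
  exact/esym/product_measure_unique.
have sectionE z : fubini_F (distribution P Y') f z = (\int[P]_w f (z, Y w))%E.
  by rewrite /fubini_F ge0_integral_distribution //; exact: measurableT_comp.
have section_ge0 z : (0 <= fubini_F (distribution P Y') f z)%E.
  exact: integral_ge0.
rewrite fubini_tonelli1 // -(@ge0_integral_distribution _ _ _ _ _ P Z') //.
- apply: ge0_le_integral => //.
  + exact: measurable_fun_fubini_tonelli_F.
  + by move=> z _; rewrite sectionE.
- by move=> z; apply: le_trans (fg z); rewrite -sectionE.
Qed.

Definition below_until (T : Type) (R : realType) (V : nat -> T -> R) (c : R)
    (k : nat) : set T :=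
  [set w | forall j, (j <= k)%N -> V j w <= c].

(** Ville's inequality for a process started below [v].  The supermartingale
    property is only used on the events that the process has not yet exceeded
    [c].  The proof follows the process that jumps to the constant [c] at the
    first time [V] exceeds [c]: its mean does not increase, and it is at least
    [c] times the probability of having exceeded [c]. *)
Lemma maximal_inequality d (T : measurableType d) (R : realType)
    (P : probability T R) (V : nat -> T -> R) (v c : R) :
  0 < c -> (forall k, measurable_fun [set: T] (V k)) ->
  (forall k w, 0 <= V k w) -> (forall w, V 0%N w <= v) ->
  (forall k, \int[P]_w (\1_(below_until V c k) w * V k.+1 w)%:E <=
             \int[P]_w (\1_(below_until V c k) w * V k w)%:E)%E ->
  ((1 - v / c)%:E <= P [set w | forall k, (V k w <= c)%R])%E.
Proof.
move=> c0 mV V0 Vv Vstep.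
pose B := below_until V c.
have mVc k : measurable [set w | V k w <= c].
  rewrite -[X in measurable X]setTI; exact: measurable_fun_le.
have mB k : measurable (B k).
  rewrite [X in measurable X](_ : _ =
    \bigcap_(j in [set j | (j <= k)%N]) [set w | V j w <= c]) //.
  exact: bigcap_measurableType.
pose W k w := c * \1_(~` B k) w + \1_(B k) w * V k w.
have mW k : measurable_fun [set: T] (W k).
  apply: measurable_funD; apply: measurable_funM => //;
    apply: measurable_indic => //; exact: measurableC.
have W0 k w : 0 <= W k w.
  by rewrite addr_ge0 // mulr_ge0 // ?ltW // indicE.
have WS k : (\int[P]_w (W k.+1 w)%:E <= \int[P]_w (W k w)%:E)%E.
  have split_int j : (\int[P]_w (c * \1_(~` B k) w + \1_(B k) w * V j w)%:E =
     \int[P]_w (c * \1_(~` B k) w)%:E + \int[P]_w (\1_(B k) w * V j w)%:E)%E.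
    rewrite -ge0_integralD //.
    - by move=> w _; rewrite lee_fin mulr_ge0 // ?ltW // indicE.
    - apply/measurable_EFinP/measurable_funM => //.
      by apply: measurable_indic; exact: measurableC.
    - by move=> w _; rewrite lee_fin mulr_ge0 // indicE.
    - by apply/measurable_EFinP/measurable_funM.
  apply: (@le_trans _ _ (\int[P]_w (c * \1_(~` B k) w + \1_(B k) w * V k.+1 w)%:E)%E).
    apply: ge0_le_integral => //.
    - by move=> w _; rewrite lee_fin.
    - exact/measurable_EFinP.
    - apply/measurable_EFinP/measurable_funD; apply: measurable_funM => //;
      apply: measurable_indic => //; exact: measurableC.
    - move=> w _; rewrite lee_fin /W !indicE !in_setC.
      have [wB|wB] := boolP (w \in B k).
        have [wB'|wB'] := boolP (w \in B k.+1); first by rewrite /=; lra.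
        have : c < V k.+1 w.
          rewrite ltNge; apply/negP => Vle; move/negP: wB'; apply.
          rewrite inE => j; rewrite leq_eqVlt => /predU1P[->//|].
          by move/set_mem: wB; apply.
        by rewrite /=; lra.
      have /negPf -> : w \notin B k.+1.
        apply: contraNN wB; rewrite !inE => wB j jk; apply: wB; exact: leqW.
      by rewrite /=; lra.
  by rewrite !split_int; apply: leeD2l; exact: Vstep.
have Wv k : (\int[P]_w (W k w)%:E <= v%:E)%E.
  elim: k => [|k IH]; last exact: le_trans (WS k) IH.
  rewrite -[leRHS]mule1 -(probability_setT P) -integral_cst //.
  apply: ge0_le_integral => //; try exact/measurable_EFinP.
  - by move=> w _; rewrite lee_fin.
  move=> w _; rewrite lee_fin /W !indicE !in_setC.
  apply: le_trans (Vv w).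
  have [wB|wB] := boolP (w \in B 0%N); first by rewrite /=; lra.
  have : c < V 0%N w.
    rewrite ltNge; apply/negP => Vle; move/negP: wB; apply.
    by rewrite inE => j; rewrite leqn0 => /eqP ->.
  by rewrite /=; lra.
have PB k : ((1 - v / c)%:E <= P (B k))%E.
  have : (c%:E * P (~` B k) <= v%:E)%E.
    apply: le_trans (Wv k).
    have mC := measurableC (mB k).
    rewrite -(setIT (~` B k)) -integral_indic // -ge0_integralZl_EFin ?(ltW c0) //.
    - apply: ge0_le_integral => //.
      + by move=> w _; rewrite lee_fin mulr_ge0 // ?ltW // indicE.
      + by apply/measurable_EFinP/measurable_funM => //; exact: measurable_indic.
      + exact/measurable_EFinP.
      + by move=> w _; rewrite -EFinM lee_fin /W lerDl mulr_ge0 // indicE.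
    - by apply/measurable_EFinP; exact: measurable_indic.
  rewrite probability_setC //.
  rewrite -(fineK (fin_num_measure P _ (mB k))) -EFinB -EFinM !lee_fin mulrBr mulr1.
  by move=> h; rewrite lerBlDr -(ler_pM2r c0) mul1r mulrDl divfK ?gt_eqF //; lra.
have -> : [set w | forall k, V k w <= c] = \bigcap_k B k.
  apply/seteqP; split => w /= h; first by move=> k _ j _; exact: h.
  by move=> k; apply: (h k).
have cvgB : (P \o B) k @[k --> \oo] --> P (\bigcap_k B k).
  apply: nonincreasing_cvg_mu => //.
  - by rewrite (le_lt_trans (probability_le1 _ _)) ?ltry.
  - by apply: bigcapT_measurable.
  - move=> k l kl; apply/subsetPset => w wB j jk; apply: wB; exact: leq_trans kl.
rewrite -(cvg_lim _ cvgB) //; apply: lime_ge; first by apply/cvg_ex; eexists; exact: cvgB.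
by apply: nearW => k; exact: PB.
Qed.

(** * Measurability of matrix expressions *)

(** The generators of [measurable_mx], named so that matrices can be given the
    structure of a measurable type. *)
Definition entry_sets (R : realType) (n : nat) : set (set 'M[R]_n) :=
  [set A | exists i j (B : set R),
     measurable B /\ A = [set M : 'M[R]_n | B (M i j)]].

Notation mxspace R n := (g_sigma_algebraType (@entry_sets R n)).

Section matrices.
Context (R : realType) (n : nat).

Lemma random_mx_measurable d (T : measurableType d) (X : T -> 'M[R]_n) :
  random_mx X -> measurable_fun [set: T] (X : T -> mxspace R n).
Proof.
move=> mX.
apply: (@measurability _ _ T (mxspace R n) setT X (@entry_sets R n)) => //.
move=> _ [_ [i [j [B [mB ->]]]] <-].
exact: (mX i j).
Qed.

Lemma measurable_entry i j :
  measurable_fun [set: mxspace R n] (fun M : mxspace R n => (M : 'M[R]_n) i j).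
Proof.
move=> _ B mB; rewrite setTI.
by apply: sub_gen_smallest; exists i, j, B.
Qed.

Lemma measurable_sqr_enorm d (S : measurableType d) (v : S -> 'cV[R]_n) :
  (forall i, measurable_fun [set: S] (fun x => v x i 0)) ->
  measurable_fun [set: S] (fun x => enorm (v x) ^+ 2).
Proof.
move=> mv; under eq_fun do rewrite sqr_enorm.
by apply: measurable_sum => i; exact: measurable_funX.
Qed.

Lemma measurable_mulmx d (S : measurableType d) (M : S -> 'M[R]_n)
    (v : S -> 'cV[R]_n) :
  (forall i j, measurable_fun [set: S] (fun x => M x i j)) ->
  (forall i, measurable_fun [set: S] (fun x => v x i 0)) ->
  forall i, measurable_fun [set: S] (fun x => (M x *m v x) i 0).
Proof.
move=> mM mv i; under eq_fun do rewrite mxE.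
by apply: measurable_sum => j; exact: measurable_funM.
Qed.

Lemma measurable_gain d (S : measurableType d) (M : S -> 'M[R]_n)
    (v : S -> 'cV[R]_n) :
  (forall i j, measurable_fun [set: S] (fun x => M x i j)) ->
  (forall i, measurable_fun [set: S] (fun x => v x i 0)) ->
  measurable_fun [set: S] (fun x => gain (M x) (v x)).
Proof.
move=> mM mv; rewrite /gain; apply: measurable_funM.
  by apply: measurable_sqr_enorm; exact: measurable_mulmx.
(* The real power of exponent -1 agrees with the inverse on [0, +oo[, including
   the value 0 at 0. *)
under eq_fun do rewrite -powR_inv1 ?sqr_ge0 //.
apply: (@measurableT_comp _ _ _ _ _ _ (@powR R ^~ (-1))) => //.
exact: measurable_sqr_enorm.
Qed.

End matrices.

(** * The past of the matrix sequence *)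

Section history.
Context (R : realType) (d : measure_display) (T : measurableType d)
  (P : probability T R) (n : nat) (Y : nat -> T -> 'M[R]_n).
Hypothesis Y_random : forall k, (0 < k)%N -> random_mx (Y k).
Hypothesis Y_indep : independent_mx P [set k | (0 < k)%N] Y.

(** These sets generate the sigma-algebra of Y_1, ..., Y_k. They are used instead
    of the preimages under the single Y_j because they are closed under
    intersection, as uniqueness of measures requires. *)
Definition cylinders (k : nat) : set (set T) :=
  [set A | exists B : nat -> set 'M[R]_n, (forall j, measurable_mx (B j)) /\
     A = \bigcap_(j in [set j | (0 < j <= k)%N]) Y j @^-1` B j].

Notation history k := (g_sigma_algebraType (cylinders k)).

Let mY k (A : set 'M[R]_n) : (0 < k)%N -> measurable_mx A ->
  measurable (Y k @^-1` A).
Proof.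
by move=> k0 mA; rewrite -[X in measurable X]setTI;
  apply: (random_mx_measurable (Y_random k0)).
Qed.

Lemma cylinder_measurable k : cylinders k `<=` measurable.
Proof.
move=> _ [B [mB ->]]; apply: bigcap_measurableType => j /andP[j0 _].
exact: mY.
Qed.

Lemma history_measurable k (A : set T) :
  (measurable : set (set (history k))) A -> measurable A.
Proof.
apply: smallest_sub; last exact: cylinder_measurable.
exact: sigma_algebra_measurable.
Qed.

Lemma measurable_id_history k :
  measurable_fun [set: T] (id : T -> history k).
Proof. by move=> _ A mA; rewrite setTI; exact: history_measurable mA. Qed.

Lemma cylinders_setI k : setI_closed (cylinders k).
Proof.
move=> _ _ [B [mB ->]] [C [mC ->]]; exists (fun j => B j `&` C j); split.
  move=> j.
  by apply: (@measurableI _ (mxspace R n)); [exact: mB|exact: mC].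
by rewrite -bigcapI; apply: eq_bigcapr => j _; rewrite preimage_setI.
Qed.

Lemma cylinders_setT k : cylinders k setT.
Proof.
exists (fun=> setT); split; last by apply/esym; rewrite -subTset => w _ j _.
by move=> j; exact: (@measurableT _ (mxspace R n)).
Qed.

(** The independence hypothesis, applied to the indices 1, ..., k + 1 and to
    1, ..., k. *)
Lemma cylinder_independent k A (C : set 'M[R]_n) :
  cylinders k A -> measurable_mx C ->
  P (A `&` Y k.+1 @^-1` C) = (P A * P (Y k.+1 @^-1` C))%E.
Proof.
move=> [B [mB ->]] mC.
pose D j := if j == k.+1 then C else B j.
have mD j : measurable_mx (D j) by rewrite /D; case: ifP.
have memi j : (j \in iota 1 k) = (0 < j <= k)%N by rewrite mem_iota add1n ltnS.
have iotaS : iota 1 k.+1 = rcons (iota 1 k) k.+1.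
  by rewrite -{1}(addn1 k) iotaD cats1 add1n.
have memS j : [set` iota 1 k.+1] j = ((j == k.+1) || (0 < j <= k)%N : Prop).
  by rewrite iotaS /= mem_rcons inE memi.
have pos_iota m j : j \in iota 1 m -> (0 < j)%N.
  by rewrite mem_iota => /andP[].
have capE : [set j | (0 < j <= k)%N] = [set` iota 1 k].
  by apply/seteqP; split => j /=; rewrite memi.
have -> : \bigcap_(j in [set j | (0 < j <= k)%N]) Y j @^-1` B j `&`
    Y k.+1 @^-1` C = \bigcap_(j in [set` iota 1 k.+1]) Y j @^-1` D j.
  apply/seteqP; split => w.
    move=> [wB wC] j; rewrite memS /D.
    by case: eqP => [-> //|_ /= jk]; exact: wB.
  move=> wD; split.
    move=> j /= jk; have := wD j; rewrite memS jk orbT => /(_ isT).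
    rewrite /D ifN //.
    by case/andP: jk => _ jk; rewrite neq_ltn ltnS jk.
  by have := wD k.+1; rewrite memS /D eqxx; exact.
rewrite capE !Y_indep ?iota_uniq //; try by move=> j; exact: pos_iota.
rewrite iotaS big_rcons /= /D eqxx; congr (_ * _)%E.
rewrite !big_seq; apply: eq_bigr => j; rewrite memi => /andP[_ jk].
by rewrite ifN // neq_ltn ltnS jk.
Qed.

(** For fixed [C] both sides are finite measures in [A] that agree on cylinders. *)
Lemma history_independent k A (C : set 'M[R]_n) :
  (measurable : set (set (history k))) A -> measurable_mx C ->
  P (A `&` Y k.+1 @^-1` C) = (P A * P (Y k.+1 @^-1` C))%E.
Proof.
move=> mA mC; have mYC := mY (ltn0Sn k) mC.
have p0 : 0 <= fine (P (Y k.+1 @^-1` C)) by rewrite fine_ge0.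
have pE : P (Y k.+1 @^-1` C) = (fine (P (Y k.+1 @^-1` C)))%:E.
  by rewrite fineK // fin_num_measure.
rewrite muleC pE.
apply: (@g_sigma_algebra_measure_unique _ _ _ (cylinders k) (@cylinder_measurable k)
  (fun=> setT) _ _ (mrestr P mYC) (mscale (NngNum p0) P)) => //.
- by move=> _; exact: cylinders_setT.
- by apply/seteqP; split => // w _; exists 0%N.
- exact: cylinders_setI.
- move=> B cB; transitivity (P B * P (Y k.+1 @^-1` C))%E.
    exact: cylinder_independent.
  by rewrite [in LHS]pE muleC.
- move=> _; apply: le_lt_trans (ltry 1); apply: probability_le1.
  exact: measurableI.
Qed.

Lemma history_entry k j a b : (0 < j <= k)%N ->
  measurable_fun [set: history k] (fun w : history k => Y j w a b).
Proof.
move=> jk _ B mB; rewrite setTI; apply: sub_gen_smallest.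
exists (fun i => if i == j then [set M : 'M[R]_n | B (M a b)] else setT); split.
  move=> i; case: ifP => _; last exact: (@measurableT _ (mxspace R n)).
  by apply: sub_gen_smallest; exists a, b, B.
apply/seteqP; split => w.
  by move=> wB i _ /=; case: eqP => [->|].
by move=> /(_ j jk) /=; rewrite eqxx.
Qed.

Lemma history_error_vec k e0 j : (j <= k)%N ->
  forall a, measurable_fun [set: history k]
    (fun w : history k => error_vec Y e0 j w a 0).
Proof.
elim: j => [|j IH] jk a /=; first exact: measurable_cst.
apply: measurable_mulmx; last by apply: IH; exact: ltnW.
by move=> b c; exact: history_entry.
Qed.

End history.

(** * Products of functions of the gains *)

Section products.
Context (R : realType) (d : measure_display) (T : measurableType d)
  (P : probability T R) (n : nat) (Y : nat -> T -> 'M[R]_n) (e0 : 'cV[R]_n).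
Hypothesis Y_random : forall k, (0 < k)%N -> random_mx (Y k).
Hypothesis Y_indep : independent_mx P [set k | (0 < k)%N] Y.
Notation history k := (g_sigma_algebraType (cylinders Y k)).

Definition gain_product (phi : R -> R) (k : nat) (w : T) : R :=
  \prod_(i < k) phi (gain (Y i.+1 w) (error_vec Y e0 i w)).

Lemma gain_product0 (phi : R -> R) w : gain_product phi 0 w = 1.
Proof. by rewrite /gain_product big_ord0. Qed.

Lemma gain_productS (phi : R -> R) k w : gain_product phi k.+1 w =
  gain_product phi k w * phi (gain (Y k.+1 w) (error_vec Y e0 k w)).
Proof. by rewrite /gain_product big_ord_recr. Qed.

Lemma gain_product_ge0 (phi : R -> R) k w : (forall x, 0 <= x -> 0 <= phi x) ->
  0 <= gain_product phi k w.
Proof. by move=> phi0; apply: prodr_ge0 => i _; apply/phi0/gain_ge0. Qed.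

Lemma sqr_enorm_error_vec k w :
  enorm (error_vec Y e0 k w) ^+ 2 = gain_product id k w * enorm e0 ^+ 2.
Proof.
elim: k => [|k IH]; first by rewrite gain_product0 mul1r.
by rewrite gain_productS /= sqr_enorm_gain IH mulrA [_ * gain_product _ _ _]mulrC.
Qed.

Lemma history_gain_product (phi : R -> R) k j : (j <= k)%N ->
  measurable_fun [set: R] phi ->
  measurable_fun [set: history k] (gain_product phi j : history k -> R).
Proof.
move=> jk mphi; apply: measurable_prod => i _.
apply: (measurableT_comp mphi); apply: measurable_gain.
  by move=> a b; apply: history_entry; rewrite /= (leq_trans (ltn_ord i) jk).
by apply: history_error_vec; rewrite ltnW // (leq_trans (ltn_ord i) jk).
Qed.

Lemma measurable_gain_product (phi : R -> R) k :
  measurable_fun [set: R] phi -> measurable_fun [set: T] (gain_product phi k).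
Proof.
move=> mphi; exact: (measurableT_comp (history_gain_product (leqnn k) mphi)
  (@measurable_id_history _ _ _ _ _ Y_random k)).
Qed.

(** The random matrix [Y k.+1] is independent of the history up to [k], which
    determines e_k, so the bound on [phi] at a fixed vector [v] applies with [v]
    replaced by e_k. *)
Lemma gain_product_bound (phi : R -> R) (c : R) : 0 < c ->
  measurable_fun [set: R] phi -> (forall x, 0 <= x -> 0 <= phi x) ->
  (forall k v, (\int[P]_w (phi (gain (Y k.+1 w) v))%:E <= 1)%E) ->
  ((1 - c^-1)%:E <= P [set w | forall k, (gain_product phi k w <= c)%R])%E.
Proof.
move=> c0 mphi phi0 mean_phi; rewrite -[c^-1]mul1r.
have mV k := measurable_gain_product k mphi.
apply: maximal_inequality => //; first by move=> k w; exact: gain_product_ge0.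
  by move=> w; rewrite gain_product0.
move=> k; set B := below_until _ _ _.
have mB : (measurable : set (set (history k))) B.
  rewrite [X in measurable X](_ : _ = \bigcap_(j in [set j | (j <= k)%N])
      ((gain_product phi j : history k -> R) @^-1` [set x | x <= c])) //.
  apply: bigcap_measurableType => j /= jk.
  rewrite -[X in measurable X]setTI; apply: history_gain_product => //.
  rewrite (_ : [set x | x <= c] = `]-oo, c]%classic) //.
pose f (x : history k * mxspace R n) : R :=
  \1_B x.1 * (gain_product phi k x.1 * phi (gain x.2 (error_vec Y e0 k x.1))).
pose g (w : history k) : R := \1_B w * gain_product phi k w.
have mg : measurable_fun [set: history k] g.
  apply: measurable_funM; first exact: measurable_indic.
  exact: history_gain_product.
have g0 w : 0 <= g w by rewrite mulr_ge0 // gain_product_ge0.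
have fE w M : f (w, M) = g w * phi (gain M (error_vec Y e0 k w)).
  by rewrite /f /g mulrA.
have mf : measurable_fun setT f.
  have -> : f = fun x => g x.1 * phi (gain x.2 (error_vec Y e0 k x.1)).
    by apply/funext => -[w M]; rewrite fE.
  apply: measurable_funM; first exact: (measurableT_comp mg measurable_fst).
  apply: (measurableT_comp mphi); apply: measurable_gain.
    move=> a b; apply: (measurableT_comp (measurable_entry a b) measurable_snd).
  move=> a.
  have me : measurable_fun [set: history k]
      (fun w : history k => error_vec Y e0 k w a 0).
    exact: history_error_vec.
  exact: (measurableT_comp me measurable_fst).
have mphiY v : measurable_fun [set: T] (fun w => phi (gain (Y k.+1 w) v)).
  apply: (measurableT_comp mphi); apply: measurable_gain => [a b|a].
    exact: Y_random.
  exact: measurable_cst.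
have := @integral_independent_le _ _ _ T (history k) (mxspace R n) R P id
  (Y k.+1) (EFin \o f) (EFin \o g).
under eq_integral do rewrite /= /f /= -gain_productS.
apply.
- exact: measurable_id_history.
- by apply: random_mx_measurable; exact: Y_random.
- by move=> A C mA mC; exact: history_independent.
- exact/measurable_EFinP.
- by move=> [w M]; rewrite lee_fin fE mulr_ge0 // phi0 // gain_ge0.
- exact/measurable_EFinP.
- move=> w /=; under eq_integral do rewrite fE EFinM.
  rewrite ge0_integralZl_EFin //; last 2 first.
  + by move=> w' _; rewrite lee_fin phi0 // gain_ge0.
  + exact/measurable_EFinP.
  by rewrite -[leRHS]mule1 lee_wpmul2l // lee_fin.
Qed.

End products.

(** * Moments of the gain at a fixed vector *)

Section gain_moments.
Context (R : realType) (d : measure_display) (T : measurableType d)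
  (P : probability T R) (n : nat) (X : T -> 'M[R]_n) (v : 'cV[R]_n).
Hypothesis X_random : random_mx X.

Lemma measurable_gain_random :
  measurable_fun [set: T] (fun w => gain (X w) v).
Proof. by apply: measurable_gain => // i; exact: measurable_cst. Qed.

Lemma integral_sqr_enorm_mulmx :
  integrable_mx P (fun w => (X w)^T *m X w) ->
  (\int[P]_w (enorm (X w *m v) ^+ 2)%:E =
   (\sum_i v i 0 * (expectation_mx P (fun w => (X w)^T *m X w) *m v) i 0)%:E)%E.
Proof.
set G := fun w => (X w)^T *m X w => intG.
have pairE (A : 'M[R]_n) : \sum_i v i 0 * (A *m v) i 0 =
    \sum_(p : 'I_n * 'I_n) v p.1 0 * v p.2 0 * A p.1 p.2.
  rewrite -(pair_big predT predT (fun i j => v i 0 * v j 0 * A i j)) /=.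
  apply: eq_bigr => i _; rewrite mxE mulr_sumr.
  by apply: eq_bigr => j _; rewrite mulrA mulrAC.
under eq_integral do rewrite sqr_enorm_mulmx pairE -sumEFin.
rewrite integral_sum //; last first.
  move=> p; under eq_fun do rewrite EFinM.
  exact/integrableZl/intG.
rewrite pairE -sumEFin; apply: eq_bigr => -[i j] _ /=.
under eq_integral do rewrite EFinM.
rewrite integralZl //; last exact: intG.
rewrite [in RHS]EFinM [in RHS]mxE expectation.unlock fineK //.
by apply: integrable_fin_num => //; exact: intG.
Qed.

Lemma integral_gain_le rho :
  integrable_mx P (fun w => (X w)^T *m X w) ->
  opnorm (expectation_mx P (fun w => (X w)^T *m X w)) <= rho ->
  (\int[P]_w (gain (X w) v)%:E <= rho%:E)%E.
Proof.
move=> intG le_rho.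
rewrite /gain; under eq_integral do rewrite mulrC EFinM.
have iv0 : 0 <= (enorm v ^+ 2)^-1 by rewrite invr_ge0 sqr_ge0.
rewrite ge0_integralZl_EFin //; last 2 first.
- by move=> w _; rewrite lee_fin sqr_ge0.
- apply/measurable_EFinP/measurable_sqr_enorm/measurable_mulmx => [i j|i].
    exact: X_random.
  exact: measurable_cst.
rewrite integral_sqr_enorm_mulmx // -EFinM lee_fin.
apply: le_trans (ler_wpM2l iv0 (quadratic_form_le _ _)) _.
apply: le_trans le_rho.
have [->|v0] := eqVneq (enorm v ^+ 2) 0; first by rewrite mulr0 mulr0 opnorm_ge0.
by rewrite mulrC mulfK.
Qed.

(** Hoeffding's lemma, with a constant worse than the optimal one but exactly
    what the bound needs.  If rho <= alpha, then (gain - rho) / alpha lies in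
    [-1, 1] and the exponential is below its chord; the chord has nonnegative
    slope, so the bound rho on the mean suffices.  If alpha < rho, the exponent
    is nonpositive. *)
Lemma exp_moment_le (rho alpha s : R) :
  0 < alpha -> 0 <= s -> 0 <= rho ->
  (\int[P]_w (gain (X w) v)%:E <= rho%:E)%E ->
  {ae P, forall w, gain (X w) v <= alpha} ->
  (\int[P]_w (expR (s * (gain (X w) v - rho)))%:E <=
   (expR ((s * alpha) ^+ 2 / 2))%:E)%E.
Proof.
move=> a0 s0 rho0 mean_le ae_le.
have mgain := measurable_gain_random.
have h0 : 0 <= s * alpha by rewrite mulr_ge0 // ltW.
apply: (@le_trans _ _ (cosh (s * alpha))%:E); last first.
  by rewrite lee_fin cosh_le_expR.
have mexp : measurable_fun [set: T] (fun w => expR (s * (gain (X w) v - rho))).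
  apply: measurableT_comp => //; apply: measurable_funM => //.
  exact: measurable_funB.
have [rho_alpha|alpha_rho] := leP rho alpha; last first.
  apply: (@le_trans _ _ 1%E); last first.
    by rewrite lee_fin; have := cosh_ge1 (s * alpha).
  have -> : (1 = \int[P]_w (cst 1 w))%E.
    by rewrite integral_cst // [X in (_ * X)%E]probability_setT mul1e.
  apply: ae_ge0_le_integral => //.
  - exact/measurable_EFinP.
  apply: filterS ae_le => w gle _; rewrite lee_fin -expR0 ler_expR.
  by rewrite mulr_ge0_le0 // subr_le0 (le_trans gle) // ltW.
(* The chord as an affine function [a + b * x] of the gain [x]. Its coefficients
   are nonnegative, so it can be integrated as a nonnegative function. *)
pose b := sinh (s * alpha) / alpha.
pose a := cosh (s * alpha) - b * rho.
have b0 : 0 <= b by rewrite divr_ge0 ?sinh_ge0 // ltW.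
have age0 : 0 <= a.
  rewrite subr_ge0; apply: (@le_trans _ _ (b * alpha)); first exact: ler_wpM2l.
  by rewrite /b divfK ?gt_eqF // sinh_le_cosh.
apply: (@le_trans _ _ (\int[P]_w (a%:E + b%:E * (gain (X w) v)%:E))%E).
  apply: ae_ge0_le_integral => //.
  - exact/measurable_EFinP.
  - by move=> w _; rewrite -EFinM -EFinD lee_fin addr_ge0 // mulr_ge0 // gain_ge0.
  - apply/measurable_EFinP; apply: measurable_funD => //.
    exact: measurable_funM.
  apply: filterS ae_le => w gle _; rewrite -EFinM -EFinD lee_fin.
  have g0 := gain_ge0 (X w) v; set x := gain _ _ in gle g0 *.
  have -> : s * (x - rho) = (s * alpha) * ((x - rho) / alpha).
    by rewrite -!mulrA [alpha * _]mulrC divfK ?gt_eqF.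
  have -> : a + b * x = cosh (s * alpha) + (x - rho) / alpha * sinh (s * alpha).
    by rewrite /a /b; ring.
  apply: expR_le_chord; rewrite ler_pdivrMr // ler_pdivlMr //.
  by apply/andP; split; lra.
rewrite ge0_integralD //; last 2 first.
- by move=> w _; rewrite -EFinM lee_fin mulr_ge0 // gain_ge0.
- by apply/measurable_EFinP; exact: measurable_funM.
rewrite integral_cst // [X in (_ * X)%E]probability_setT mule1.
rewrite ge0_integralZl_EFin //; last 2 first.
- by move=> w _; rewrite lee_fin gain_ge0.
- exact/measurable_EFinP.
apply: (@le_trans _ _ (a%:E + b%:E * rho%:E)%E).
  by apply: leeD2l; apply: lee_wpmul2l.
by rewrite -EFinM -EFinD lee_fin /a subrK.
Qed.

End gain_moments.

(** * Uniform bounds on the error vectors *)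

Section error_bounds.
Context (R : realType) (d : measure_display) (T : measurableType d)
  (P : probability T R) (n : nat) (Y : nat -> T -> 'M[R]_n) (e0 : 'cV[R]_n).
Hypothesis Y_random : forall k, (0 < k)%N -> random_mx (Y k).
Hypothesis Y_indep : independent_mx P [set k | (0 < k)%N] Y.

Lemma measurable_forall_le (f : nat -> T -> R) (D : set nat) (b : nat -> R) :
  (forall k, measurable_fun [set: T] (f k)) ->
  measurable [set w | forall k, D k -> f k w <= b k].
Proof.
move=> mf.
rewrite [X in measurable X](_ : _ = \bigcap_(k in D) [set w | f k w <= b k]) //.
apply: bigcap_measurableType => k _; rewrite -[X in measurable X]setTI.
exact: measurable_fun_le.
Qed.

Lemma measurable_sqr_error_vec k :
  measurable_fun [set: T] (fun w => enorm (error_vec Y e0 k w) ^+ 2).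
Proof.
apply: measurable_sqr_enorm; elim: k => [|k IH] i /=.
  exact: measurable_cst.
by apply: measurable_mulmx => // a b; exact: Y_random.
Qed.

Lemma measurable_error_bound (D : set nat) (b : nat -> R) :
  measurable [set w | forall k, D k -> enorm (error_vec Y e0 k w) ^+ 2 <= b k].
Proof. exact/measurable_forall_le/measurable_sqr_error_vec. Qed.

Lemma error_bound_of_gain_product (phi : R -> R) (c : R) (D : set nat)
    (b : nat -> R) : 0 < c ->
  measurable_fun [set: R] phi -> (forall x, 0 <= x -> 0 <= phi x) ->
  (forall k v, (\int[P]_w (phi (gain (Y k.+1 w) v))%:E <= 1)%E) ->
  (forall k w, D k -> gain_product Y e0 phi k w <= c ->
     enorm (error_vec Y e0 k w) ^+ 2 <= b k) ->
  ((1 - c^-1)%:E <= P [set w | forall k, D k ->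
     (enorm (error_vec Y e0 k w) ^+ 2 <= b k)%R])%E.
Proof.
move=> c0 mphi phi0 mean_phi bound.
apply: le_trans (gain_product_bound e0 Y_random Y_indep c0 mphi phi0 mean_phi) _.
apply: le_measure; rewrite ?inE.
- rewrite [X in measurable X](_ : _ = [set w | forall k, setT k ->
    gain_product Y e0 phi k w <= c]); last first.
    by apply/seteqP; split => w /= h k; have := h k; [|exact].
  apply: measurable_forall_le => k; apply: measurable_gain_product => //.
- exact: measurable_error_bound.
- by move=> w /= h k Dk; exact: bound.
Qed.

Lemma gain_product_expR (s rho K : R) k w :
  gain_product Y e0 (fun x => expR (s * (x - rho) - K)) k w =
  expR (s * (\sum_(i < k) gain (Y i.+1 w) (error_vec Y e0 i w) - k%:R * rho)
        - k%:R * K).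
Proof.
elim: k => [|k IH].
  by rewrite gain_product0 big_ord0 !mul0r !subr0 mulr0 expR0.
rewrite gain_productS IH -expRD big_ord_recr /= -natr1; congr expR; ring.
Qed.

(** This is [x <= exp (x - 1)], factor by factor. *)
Lemma gain_product_le_expR k w : gain_product Y e0 id k w <=
  expR (\sum_(i < k) gain (Y i.+1 w) (error_vec Y e0 i w) - k%:R).
Proof.
elim: k => [|k IH]; first by rewrite gain_product0 big_ord0 subr0 expR0.
rewrite gain_productS big_ord_recr /= -natr1.
set S := \sum_(_ < _) _ in IH *; set x := gain _ _.
have -> : S + x - (k%:R + 1) = (S - k%:R) + (x - 1) by ring.
rewrite expRD ler_pM //; first exact: gain_product_ge0.
  exact: gain_ge0.
by have := expR_ge1Dx (x - 1); rewrite addrC subrK.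
Qed.

Lemma gain_product_div (rho : R) k w :
  gain_product Y e0 (fun x => x / rho) k w = gain_product Y e0 id k w / rho ^+ k.
Proof.
elim: k => [|k IH]; first by rewrite !gain_product0 expr0 divr1.
by rewrite !gain_productS IH exprSr invfM; ring.
Qed.

(** The gain of Y_1 at e_0 is nonnegative with mean zero, so it vanishes almost
    surely, and with it all products of gains of positive length. *)
Lemma error_bound_mean0 c : 1 <= c ->
  (\int[P]_w (gain (Y 1%N w) e0)%:E <= 0)%E ->
  P [set w | forall k, setT k ->
    enorm (error_vec Y e0 k w) ^+ 2 <= c * 0 ^+ k * enorm e0 ^+ 2] = 1%E.
Proof.
move=> c1 mean0; set A := [set w | _].
have mA : measurable A := measurable_error_bound setT _.
have mgain : measurable_fun [set: T] (EFin \o (fun w => gain (Y 1%N w) e0)).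
  by apply/measurable_EFinP/measurable_gain_random; exact: Y_random.
have ae_gain0 : ae_eq P [set: T] (EFin \o (fun w => gain (Y 1%N w) e0)) (cst 0%E).
  apply/(ae_eq_integral_abs P measurableT mgain)/eqP; rewrite eq_le.
  rewrite integral_ge0 // andbT; apply: le_trans mean0.
  rewrite le_eqVlt; apply/orP; left; apply/eqP; apply: eq_integral => w _.
  by rewrite /= ger0_norm // gain_ge0.
have ae_A : {ae P, forall w, A w}.
  apply: filterS ae_gain0 => w /(_ I) /= [gain0] [|k] _.
    by rewrite expr0 mulr1 ler_peMl // sqr_ge0.
  rewrite sqr_enorm_error_vec /gain_product big_ord_recl /= gain0 !mul0r.
  by rewrite expr0n mulr0 mul0r.
have mCA := measurableC mA.
have PCA : P (~` A) = 0%E by apply: measure_negligible.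
by rewrite -[A]setCK probability_setC // PCA sube0.
Qed.

End error_bounds.

Theorem theorem1p3 (R : realType) (d : measure_display)
    (T : measurableType d) (P : probability T R) (n : nat)
    (Y : nat -> T -> 'M[R]_n) (e0 : 'cV[R]_n) (rho : R)
    (Y_random : forall k, (0 < k)%N -> random_mx (Y k))
    (Y_indep : independent_mx P [set k | (0 < k)%N] Y)
    (YtY_int : forall k, (0 < k)%N ->
       integrable_mx P (fun w => (Y k w)^T *m Y k w))
    (Y_rho : (ereal_sup
         [set (opnorm (expectation_mx P (fun w => (Y k w)^T *m Y k w)))%:E
         | k in [set k | (0 < k)%N]] <= rho%:E)%E) :
  (forall eps : R, 0 < eps <= 1 ->
     ((1 - eps)%:E <=
      P [set w | forall k : nat,
           (enorm (error_vec Y e0 k w) ^+ 2 <=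
              eps^-1 * rho ^+ k * enorm e0 ^+ 2)%R])%E)
  /\
  (forall alpha : R, 1 <= alpha ->
     {ae P, forall w, (ereal_sup
         [set (opnorm ((Y k w)^T *m Y k w))%:E
         | k in [set k | (0 < k)%N]] <= alpha%:E)%E} ->
     forall (k : nat) (eps : R), 0 < eps <= 1 ->
     ((1 - eps)%:E <=
      P [set w | forall t : nat, (t <= k)%N ->
           (enorm (error_vec Y e0 t w) ^+ 2 <=
              expR (- (t%:R * (1 - rho)) +
                    alpha * Num.sqrt (2 * k%:R * ln eps^-1)) *
              enorm e0 ^+ 2)%R])%E).
Proof.
have rho_ub k : (0 < k)%N ->
    opnorm (expectation_mx P (fun w => (Y k w)^T *m Y k w)) <= rho.
  move=> k0; rewrite -lee_fin; apply: le_trans Y_rho.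
  by apply: ereal_sup_ubound; exists k.
have mean_gain k v : (\int[P]_w (gain (Y k.+1 w) v)%:E <= rho%:E)%E.
  apply: integral_gain_le; [exact: Y_random|exact: YtY_int|exact: rho_ub].
have rho0 : 0 <= rho by apply: le_trans (rho_ub 1%N isT); exact: opnorm_ge0.
split.
- move=> eps /andP[eps0 eps1].
  rewrite [X in P X](_ : _ = [set w | forall k, setT k ->
      enorm (error_vec Y e0 k w) ^+ 2 <= eps^-1 * rho ^+ k * enorm e0 ^+ 2]);
    last by apply/seteqP; split => w /= h k; [move=> _|]; exact: h.
  have [rho_eq0|rho_neq0] := eqVneq rho 0.
    have eps_inv : 1 <= eps^-1 by rewrite invf_ge1.
    rewrite rho_eq0 error_bound_mean0 //.
      by rewrite lee_fin lerBlDr lerDl ltW.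
    by apply: le_trans (mean_gain 0%N e0) _; rewrite rho_eq0.
  have rho_gt0 : 0 < rho by rewrite lt_def rho_neq0.
  rewrite -[X in 1 - X]invrK.
  apply: (@error_bound_of_gain_product _ _ _ _ _ _ _ _ _ (fun x => x / rho)) => //.
  + by rewrite invr_gt0.
  + exact: measurable_funM.
  + by move=> x x0; rewrite divr_ge0.
  + move=> k v; under eq_integral do rewrite mulrC EFinM.
    rewrite ge0_integralZl_EFin ?invr_ge0 //; last 2 first.
    * by move=> w _; rewrite lee_fin gain_ge0.
    * by apply/measurable_EFinP/measurable_gain_random; exact: Y_random.
    apply: le_trans (lee_wpmul2l _ (mean_gain k v)) _.
      by rewrite lee_fin invr_ge0.
    by rewrite -EFinM mulVf.
  + move=> k w _; rewrite gain_product_div sqr_enorm_error_vec.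
    rewrite ler_pdivrMr ?exprn_gt0 // => le_c.
    by rewrite ler_wpM2r // sqr_ge0.
move=> alpha alpha1 ae_alpha k eps /andP[eps0 eps1].
have alpha0 : 0 < alpha by apply: lt_le_trans alpha1.
have [->|eps_neq1] := eqVneq eps 1; first by rewrite subrr measure_ge0.
have L_gt0 : 0 < ln eps^-1 by rewrite ln_gt0 // invf_gt1 // lt_def eq_sym eps_neq1.
set L := ln eps^-1 in L_gt0 *.
have expL : expR L = eps^-1 by rewrite lnK // posrE invr_gt0.
have [->|k_neq0] := eqVneq k 0%N.
  rewrite [X in P X](_ : _ = setT).
    by rewrite probability_setT lee_fin lerBlDr lerDl ltW.
  rewrite -subTset => w _ t; rewrite leqn0 => /eqP -> /=.
  by rewrite mul0r oppr0 mulr0 mul0r sqrtr0 mulr0 addr0 expR0 mul1r.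
have k_gt0 : 0 < k%:R :> R by rewrite ltr0n lt0n.
have ae_gain j v : {ae P, forall w, gain (Y j.+1 w) v <= alpha}.
  apply: filterS ae_alpha => w; rewrite -lee_fin; apply: le_trans.
  apply: le_trans (ereal_sup_ubound _); last by exists j.+1.
  by rewrite lee_fin gain_le.
(* The optimal [s] minimizes L / s + k * s * alpha^2 / 2; it makes both terms
   equal, that is (s * alpha)^2 / 2 = L / k. *)
pose u := Num.sqrt (2 * L / k%:R).
have u_gt0 : 0 < u by rewrite sqrtr_gt0 divr_gt0 // mulr_gt0.
have uE : u ^+ 2 / 2 = L / k%:R.
  rewrite sqr_sqrtr; last by rewrite divr_ge0 ?mulr_ge0 // ltW.
  by field; rewrite gt_eqF.
pose s := u / alpha.
have s_gt0 : 0 < s by rewrite divr_gt0.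
have sE : s * alpha = u by rewrite divfK ?gt_eqF.
rewrite -[X in 1 - X]invrK.
apply: (@error_bound_of_gain_product _ _ _ _ _ _ _ _ _
  (fun x => expR (s * (x - rho) - L / k%:R)) _ [set t | (t <= k)%N]) => //.
- by rewrite invr_gt0.
- apply: measurableT_comp => //; apply: measurable_funB => //.
  by apply: measurable_funM => //; exact: measurable_funB.
- move=> j v; under eq_integral do rewrite expRD mulrC EFinM.
  rewrite ge0_integralZl_EFin ?expR_ge0 //; last first.
  + apply/measurable_EFinP; apply: measurableT_comp => //.
    apply: measurable_funM => //; apply: measurable_funB => //.
    by apply: measurable_gain_random; exact: Y_random.
  have := @exp_moment_le _ _ _ P _ _ v (Y_random j.+1 isT) rho alpha s
    alpha0 (ltW s_gt0) rho0 (mean_gain j v) (ae_gain j v).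
  rewrite sE uE => mom.
  apply: le_trans (lee_wpmul2l _ mom) _; first by rewrite lee_fin expR_ge0.
  by rewrite -EFinM -expRD addNr expR0.
move=> t w /= tk; rewrite gain_product_expR -expL ler_expR => le_L.
rewrite sqr_enorm_error_vec ler_wpM2r ?sqr_ge0 //.
apply: le_trans (gain_product_le_expR _ _ _ _) _; rewrite ler_expR.
set S := \sum_(_ < _) _ in le_L *.
have dev : S - t%:R * rho <= alpha * Num.sqrt (2 * k%:R * L).
  (* As t <= k, the compensator t * (L / k) costs at most another L. *)
  have tL : t%:R * (L / k%:R) <= L.
    rewrite mulrCA ler_piMr ?(ltW L_gt0) // ler_pdivrMr // mul1r ler_nat //.
  have uu : u * Num.sqrt (2 * k%:R * L) = 2 * L.
    rewrite -sqrtrM; last by rewrite divr_ge0 ?mulr_ge0 // ltW.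
    have -> : 2 * L / k%:R * (2 * k%:R * L) = (2 * L) ^+ 2.
      by field; rewrite gt_eqF.
    by rewrite sqrtr_sqr ger0_norm // mulr_ge0 // ltW.
  rewrite -(ler_pM2l s_gt0) mulrA sE uu.
  by move: le_L tL; rewrite -/L; lra.
by move: dev; lra.
Qed.
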